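(* Let $K_n$ be the complete graph on $n$ vertices with price function $P$, and label its vertices so that their prices satisfy $p^{1}\le p^{2}\le\cdots\le p^{n}$. Then for every integer $t$ with $1\le t<n$, \[ \pi_{P}^{t}(K_{n})=\sum_{i=t+1}^{n}(p^{i}-1)+p^{n}(t-1)+1. \]
   Context: A configuration of $k$ pebbles on a graph $G$ is a function $C:V(G)\to\mathbb{Z}_{\ge 0}$ with $\sum_{v}C(v)=k$. A price function is a function $P:V(G)\to\mathbb{Z}_{\ge 2}$. A pebbling move along an edge $v_hv_k$ removes $P(v_h)$ pebbles from $v_h$ and adds one pebble to $v_k$; it is allowed only if the result has no negative values. A configuration $C'$ is derivable from $C$ if it is obtained from $C$ by a finite sequence of pebbling moves. A configuration covers a set of vertices if it is nonzero at each of them. A configuration $C$ is $t$-solvable if for every set of $t$ vertices there is a configuration derivable from $C$ covering that set. For $1\le t\le n$, $\pi_P^t(G)$ is the minimum $k$ such that every configuration of $k$ pebbles on $G$ (with price function $P$) is $t$-solvable. *)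

(* Defs.v *)
From mathcomp Require Import all_boot.
From Stdlib Require Import Relations.Relation_Operators.

Set Implicit Arguments.
Unset Strict Implicit.
Unset Printing Implicit Defensive.

Record sgraph := SGraph {
  vertex :> finType;
  adj : rel vertex;
  adj_sym : symmetric adj;
  adj_irrefl : irreflexive adj }.

Definition neq_rel (T : eqType) : rel T := fun x y => x != y.

Lemma neq_rel_sym (T : eqType) : symmetric (@neq_rel T).
Proof. by move=> x y; rewrite /neq_rel eq_sym. Qed.

Lemma neq_rel_irrefl (T : eqType) : irreflexive (@neq_rel T).
Proof. by move=> x; rewrite /neq_rel eqxx. Qed.

Definition complete_graph (n : nat) : sgraph :=
  SGraph (@neq_rel_sym 'I_n) (@neq_rel_irrefl 'I_n).

Section Pebbling.
Variable G : sgraph.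

Definition config := {ffun G -> nat}.

Definition pebbles (C : config) : nat := \sum_v C v.

Definition price_function (P : G -> nat) : Prop := forall v, 2 <= P v.

Variable P : G -> nat.

(* The guard [P u <= C u] says that no value becomes negative, so the
   truncated subtraction is exact; [u] and [w] are distinct since [adj] is
   irreflexive. *)
Definition pebbling_move (C C' : config) : Prop :=
  exists u w : G, [/\ adj u w, P u <= C u &
    C' = [ffun x => if x == u then C x - P u
                    else if x == w then C x + 1 else C x]].

Definition derivable (C C' : config) : Prop :=
  clos_refl_trans config pebbling_move C C'.

Definition covers (C : config) (S : {set G}) : Prop :=
  forall v, v \in S -> C v != 0.

Definition solvable (t : nat) (C : config) : Prop :=
  forall S : {set G}, #|S| = t -> exists C', derivable C C' /\ covers C' S.

Definition all_solvable (t k : nat) : Prop :=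
  forall C : config, pebbles C = k -> solvable t C.

(* [is_pebbling_number t k] states pi_P^t(G) = k, including that the minimum
   exists. *)
Definition is_pebbling_number (t k : nat) : Prop :=
  all_solvable t k /\ forall k', all_solvable t k' -> k <= k'.

End Pebbling.

(* [v 1, ..., v n] lists every vertex of [G] exactly once; the values of [v]
   at other indices are irrelevant. *)
Definition labelling (G : sgraph) (n : nat) (v : nat -> G) : Prop :=
  perm_eq [seq v i | i <- iota 1 n] (enum G).

(* Main.v *)
Require Import Defs.
From mathcomp Require Import all_boot.
From Stdlib Require Import Relations.Relation_Operators.
From mathcomp Require Import zify.

Set Implicit Arguments.
Unset Strict Implicit.
Unset Printing Implicit Defensive.

(** Fix a target set S of size t.  Paying P u for each move out of u, while
    keeping one pebble on every occupied target, the vertex u supports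
    (C u - [u in S]) / P u moves; on a complete graph S can be covered as soon
    as these add up to the number of empty targets.  If C falls short of this
    with m >= 1 empty targets, then C has at most
    sum_{u notin S} (P u - 1) + (t - m) p^n + (m - 1) p^n pebbles, and the
    first sum is largest when S consists of the t cheapest vertices.
    Conversely, for that S, put p^i - 1 pebbles on v_i for t < i < n and
    t p^n - 1 on v_n: the potential
    sum_{u in S} C u + sum_{u notin S} C u / P u never increases along moves,
    is t - 1 at this configuration, and is at least t once S is covered. *)

Lemma sum_nat_pred1 (T : finType) (a : T) : \sum_x (x == a) = 1.
Proof.
by rewrite (bigD1 a) //= eqxx big1 // => x /negbTE ->.
Qed.

(** The sums agree on [A :&: B], and the two set differences have equal size, so [c] separates them
    term by term. *)
Lemma leq_sum_exchange (T : finType) (A B : {set T}) (q : T -> nat) (c : nat) :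
  #|A| = #|B| -> (forall x, x \in A :\: B -> q x <= c) ->
  (forall x, x \in B :\: A -> c <= q x) ->
  \sum_(x in A) q x <= \sum_(x in B) q x.
Proof.
move=> cardAB leA leB.
rewrite (big_setID B) [X in _ <= X](big_setID A) /= setIC leq_add2l.
apply: (@leq_trans (#|A :\: B| * c)); first by rewrite -sum_nat_const leq_sum.
suff -> : #|A :\: B| = #|B :\: A| by rewrite -sum_nat_const leq_sum.
by rewrite !cardsD cardAB setIC.
Qed.

Section Potentials.
Variables (G : sgraph) (P : G -> nat).
Hypothesis hP : price_function P.

(** Minimality has to exclude every smaller number of pebbles, so one bad configuration gets thinned
    to exactly [k] pebbles. *)
Lemma exists_subconfig (C : config G) k :
  k <= pebbles C ->
  exists2 D : config G, (forall x, D x <= C x) & pebbles D = k.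
Proof.
move=> lekC; rewrite -(subKn lekC); move: (_ - k) => d.
elim: d => [|d [D leDC pD]]; first by exists C; rewrite ?subn0.
(* If [D] is already empty, truncated subtraction makes the next target count 0 as well. *)
have [D0|] := posnP (pebbles D).
  by exists D => //; rewrite D0 subnS -pD D0.
rewrite lt0n sum_nat_eq0 => /forallPn[a /= a_gt0].
exists [ffun x => D x - (x == a)] => [x|].
  by rewrite ffunE (leq_trans (leq_subr _ _)).
rewrite subnS -pD /pebbles.
under eq_bigr do rewrite ffunE.
rewrite sumnB ?sum_nat_pred1 ?subn1 // => x _.
by case: eqP => // ->; rewrite lt0n.
Qed.

Definition coverage_potential (S : {set G}) (C : config G) : nat :=
  \sum_x (if x \in S then C x else C x %/ P x).

Lemma coverage_potential_mono (S : {set G}) (C D : config G) :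
  (forall x, C x <= D x) -> coverage_potential S C <= coverage_potential S D.
Proof.
by move=> leCD; apply: leq_sum => x _; case: ifP => // _; apply: leq_div2r.
Qed.

Lemma coverage_potential_move (S : {set G}) (C C' : config G) :
  pebbling_move P C C' -> coverage_potential S C' <= coverage_potential S C.
Proof.
move=> [u [w [uw Pu ->]]].
(* The term at [u] drops by at least 1 and the term at [w] rises by at most 1. Adding the indicators
   of [u] and [w] to opposite sides makes the comparison termwise. *)
suff : coverage_potential S [ffun x => if x == u then C x - P u
      else if x == w then C x + 1 else C x] + \sum_x (x == u)
    <= coverage_potential S C + \sum_x (x == w).
  by rewrite !sum_nat_pred1 leq_add2r.
rewrite -!big_split /=; apply: leq_sum => x _; rewrite ffunE.
have Px := hP x.
have [->|xu] := eqVneq x u.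
  have Pu0 : 0 < P u by apply: leq_trans (hP u).
  have -> : (u == w) = false by apply/eqP => e; move: uw; rewrite e adj_irrefl.
  case: ifP => _; first by have := hP u; lia.
  by rewrite -{2}(subnK Pu) divnDr // divnn Pu0; lia.
have [_|_] := eqVneq x w; last by [].
case: ifP => _; first by lia.
have Px0 : 0 < P x by apply: ltnW.
have -> : C x %/ P x + true = (C x + P x) %/ P x by rewrite divnDr // divnn Px0.
by rewrite addn0 leq_div2r // leq_add2l.
Qed.

Lemma coverage_potential_derivable (S : {set G}) (C C' : config G) :
  derivable P C C' -> coverage_potential S C' <= coverage_potential S C.
Proof.
elim=> [D D' /coverage_potential_move //|//|D E F _ leED _ leFE].
exact: leq_trans leFE leED.
Qed.

Lemma card_covers_potential (S : {set G}) (C : config G) :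
  covers C S -> #|S| <= coverage_potential S C.
Proof.
move=> cov; rewrite -sum1_card big_mkcond /=; apply: leq_sum => x _.
by case: ifP => // /cov; rewrite lt0n.
Qed.

Definition spare_moves (S : {set G}) (C : config G) : nat :=
  \sum_x (C x - (x \in S)) %/ P x.

Definition uncovered (S : {set G}) (C : config G) : {set G} :=
  [set x in S | C x == 0].

Hypothesis complete : forall u w : G, u != w -> adj u w.

(** A spare move from some [u] onto an empty target [w] covers [w] and uncovers nothing, as [u]
    keeps a pebble if it is a target. It uses up at most one spare move, so the inequality
    survives. *)
Lemma spare_moves_cover (S : {set G}) (C : config G) :
  #|uncovered S C| <= spare_moves S C ->
  exists C', derivable P C C' /\ covers C' S.
Proof.
move: {2}#|_| (leqnn #|uncovered S C|) => m.
elim: m C => [|m IHm] C leCm spare.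
  exists C; split=> [|x xS]; first exact: rt_refl.
  move: leCm; rewrite leqn0 cards_eq0 => /eqP U0.
  by apply/negP => Cx; have := in_set0 x; rewrite -U0 inE xS Cx.
have [U0|[w wU]] := set_0Vmem (uncovered S C).
  by apply: IHm => //; rewrite U0 cards0.
have : spare_moves S C != 0.
  by rewrite -lt0n (leq_trans _ spare) // (cardD1 w) wU.
rewrite sum_nat_eq0 => /forallPn[u /=]; rewrite -lt0n.
have Pu0 : 0 < P u by apply: leq_trans (hP u).
rewrite divn_gt0 // => leP.
move: (wU); rewrite inE => /andP[wS /eqP Cw].
have uw : u != w by apply/eqP => e; move: leP Pu0; rewrite e Cw; lia.
pose D : config G := [ffun x => if x == u then C x - P u
                    else if x == w then C x + 1 else C x].
have CD : pebbling_move P C D.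
  by exists u, w; split=> //; [exact: complete | lia].
have subU : uncovered S D \subset uncovered S C :\ w.
  apply/subsetP => x; rewrite !inE ffunE => /andP[xS].
  have [xu|xu] := eqVneq x u.
    by move: leP; rewrite -xu xS; have := hP x; lia.
  by have [->|xw] := eqVneq x w; [lia | rewrite xS].
have cardU : #|uncovered S D| < #|uncovered S C|.
  by rewrite [X in _ < X](cardsD1 w) wU ltnS subset_leq_card.
have spareD : spare_moves S C <= spare_moves S D + 1.
  rewrite -(sum_nat_pred1 u) -big_split /=; apply: leq_sum => x _.
  rewrite ffunE; have [->|xu] := eqVneq x u.
    have -> : C u - (u \in S) = (C u - P u - (u \in S)) + P u by lia.
    by rewrite divnDr // divnn Pu0.
  by rewrite addn0; apply: leq_div2r; case: eqP => _ //; lia.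
have [C' [DC' cov]] : exists C', derivable P D C' /\ covers C' S.
  by apply: IHm; lia.
exists C'; split=> //.
by apply: rt_trans DC'; apply: rt_step.
Qed.

Lemma pebbles_spare_bound (S : {set G}) (C : config G) (M : nat) :
  (forall x, P x <= M) -> spare_moves S C < #|uncovered S C| ->
  pebbles C <= \sum_(x in ~: S) (P x - 1) + M * (#|S| - 1).
Proof.
move=> leM short.
(* Division with remainder: off [S] the remainder is at most [P x - 1]; on a covered target the
   remainder and the kept pebble together are at most [P x <= M]. *)
have leC x : C x <= (if x \in ~: S then P x - 1 else 0)
    + M * (x \in S :\: uncovered S C) + M * ((C x - (x \in S)) %/ P x).
  have Px : 0 < P x by apply: leq_trans (hP x).
  have := divn_eq (C x - (x \in S)) (P x).
  have := ltn_pmod (C x - (x \in S)) Px.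
  have := leM x; rewrite !inE.
  move: (_ %/ _) (_ %% _) => q r.
  by case: (x \in S); case: (C x =P 0) => /=; nia.
apply: leq_trans (leq_sum _ (fun x _ => leC x)) _.
rewrite !big_split /= -big_mkcond -!big_distrr /= -addnA leq_add2l.
(* What remains after cancelling [M]: covered targets and spare moves number at most [#|S| - 1]
   together. *)
rewrite -mulnDr leq_mul2l; apply/orP; right.
have -> : \sum_x (x \in S :\: uncovered S C) = #|S| - #|uncovered S C|.
  rewrite -big_mkcond /= sum1_card cardsD.
  by have /setIidPr -> : uncovered S C \subset S
    by apply/subsetP => x; rewrite inE => /andP[].
have : #|uncovered S C| <= #|S|.
  by apply/subset_leq_card/subsetP => x; rewrite inE => /andP[].
by move: short; rewrite /spare_moves; lia.
Qed.

End Potentials.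

Section Labelling.
Variables (G : sgraph) (n : nat) (v : nat -> G).
Hypothesis hv : labelling n v.

(** With prices sorted along [v], the complement consists of [t] cheapest vertices, the hardest
    target set. *)
Definition labelled_after (t : nat) : {set G} :=
  [set x in [seq v i | i <- iota t.+1 (n - t)]].

Lemma labelling_uniq : uniq [seq v i | i <- iota 1 n].
Proof. by rewrite (perm_uniq hv) enum_uniq. Qed.

Lemma labelled_cat t : t <= n -> [seq v i | i <- iota 1 n] =
  [seq v i | i <- iota 1 t] ++ [seq v i | i <- iota t.+1 (n - t)].
Proof. by move=> letn; rewrite -map_cat -[t.+1]add1n -iotaD subnKC. Qed.

Lemma labelled_after_uniq t :
  t <= n -> uniq [seq v i | i <- iota t.+1 (n - t)].
Proof.
by move=> letn; have := labelling_uniq; rewrite (labelled_cat letn) cat_uniq;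
  case/and3P.
Qed.

Lemma labelled_afterP t x :
  reflect (exists2 i, t < i <= n & x = v i) (x \in labelled_after t).
Proof.
rewrite inE; apply: (iffP mapP) => -[i lei ->]; exists i => //.
  by move: lei; rewrite mem_iota; lia.
by rewrite mem_iota; lia.
Qed.

Lemma notin_labelled_after t x :
  x \notin labelled_after t -> exists2 i, 1 <= i <= minn t n & x = v i.
Proof.
have : x \in [seq v i | i <- iota 1 n] by rewrite (perm_mem hv) mem_enum.
case/mapP=> i; rewrite mem_iota => lei -> /labelled_afterP nlt; exists i => //.
have [lt_ti|] := ltnP t i; last by lia.
by case: nlt; exists i => //; lia.
Qed.

Lemma card_labelled : #|G| = n.
Proof. by rewrite cardE -(perm_size hv) size_map size_iota. Qed.

Lemma card_labelled_after t : t <= n -> #|labelled_after t| = n - t.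
Proof.
move=> letn; rewrite cardsE (card_uniqP (labelled_after_uniq letn)).
by rewrite size_map size_iota.
Qed.

Lemma sum_labelled_after t (F : G -> nat) :
  t <= n -> \sum_(x in labelled_after t) F x = \sum_(t.+1 <= i < n.+1) F (v i).
Proof.
move=> letn; under eq_bigl do rewrite inE.
by rewrite -big_uniq ?labelled_after_uniq // big_map /index_iota subSS.
Qed.

End Labelling.

Theorem theorem12 (n : nat) (P : complete_graph n -> nat)
    (hP : price_function P)
    (v : nat -> complete_graph n) (hv : labelling n v)
    (hsorted : forall i j : nat, 1 <= i -> i <= j -> j <= n ->
       P (v i) <= P (v j))
    (t : nat) (ht1 : 1 <= t) (htn : t < n) :
  is_pebbling_number P t
    (\sum_(t.+1 <= i < n.+1) (P (v i) - 1) + P (v n) * (t - 1) + 1).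
Proof.
have letn := ltnW htn.
rewrite -(sum_labelled_after hv (fun x => P x - 1) letn).
set B := labelled_after n v t.
have cardB : #|B| = n - t by apply: card_labelled_after.
split=> [C pC S cardS | k solv].
  have [//|short] := leqP #|uncovered S C| (spare_moves P S C).
    exact: spare_moves_cover.
  have leM x : P x <= P (v n).
    have [i lei ->] : exists2 i, 1 <= i <= minn n n & x = v i.
      (* No label exceeds [n], so [labelled_after n v n] is empty and every vertex gets a label. *)
      apply: (notin_labelled_after hv); apply/labelled_afterP => -[i]; lia.
    by apply: hsorted; lia.
  have := pebbles_spare_bound hP leM short; rewrite pC cardS.
  suff : \sum_(x in ~: S) (P x - 1) <= \sum_(x in B) (P x - 1) by lia.
  (* The price at label [t] separates: vertices outside [B] have labels at most [t], those in [B]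
     larger ones. *)
  apply: (@leq_sum_exchange _ _ _ _ (P (v t) - 1)) => [|x|x].
  - by rewrite cardB cardsCs setCK cardS (card_labelled hv).
  - rewrite in_setD => /andP[/(notin_labelled_after hv)[i lei ->] _].
    by rewrite leq_sub2r // hsorted //; lia.
  - rewrite in_setD => /andP[_ /labelled_afterP[i lei ->]].
    by rewrite leq_sub2r // hsorted //; lia.
rewrite addn1 ltnNge; apply/negP => lek.
pose C : config (complete_graph n) :=
  [ffun x => if x \in B then P x - 1 + (x == v n) * (P (v n) * (t - 1)) else 0].
have vnB : v n \in B by apply/labelled_afterP; exists n => //; lia.
have pC : pebbles C = \sum_(x in B) (P x - 1) + P (v n) * (t - 1).
  rewrite /pebbles; under eq_bigr do rewrite ffunE.
  rewrite -big_mkcond big_split /= -big_distrl /=.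
  suff -> : \sum_(x in B) (x == v n) = 1 by rewrite mul1n.
  by rewrite (bigD1 (v n)) //= eqxx big1 // => x /andP[_ /negbTE ->].
(* Only [v n] contributes: targets are empty, and every other vertex of [B] holds one pebble less
   than its price. *)
have potC : coverage_potential P (~: B) C = t - 1.
  rewrite /coverage_potential (bigD1 (v n)) //= big1 => [|x /negbTE xn].
    have Pn0 : 0 < P (v n) by apply: leq_trans (hP _).
    rewrite in_setC vnB ffunE vnB eqxx mul1n /= addn0 mulnC.
    by rewrite divnDr ?dvdn_mull // mulnK // divn_small //; lia.
  rewrite in_setC ffunE xn; case: (x \in B) => //=.
  by rewrite divn_small //; have := hP x; lia.
(* Removing pebbles cannot raise the potential, so [D] is as bad as [C]. *)
have [D leDC pD] : exists2 D : config (complete_graph n),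
    (forall x, D x <= C x) & pebbles D = k.
  by apply: exists_subconfig; rewrite pC.
have cardS : #|~: B| = t.
  by rewrite cardsCs setCK cardB (card_labelled hv) subKn.
have [D' [DD' cov]] := solv D pD _ cardS.
have := card_covers_potential P cov.
have := coverage_potential_derivable hP (~: B) DD'.
have := coverage_potential_mono P (~: B) leDC.
by rewrite potC cardS; lia.
Qed.
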